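(* Let $G=(V,w,m)$ be a locally finite weighted graph, let $R\ge1$ be an integer, and let $K\in\mathbb{R}$. The following are equivalent: (i) For all $x,y\in V$ with $d(x,y)\le R$ we have $K^q_R(x,y)\ge K$. (ii) For all $f\in\ell^\infty(V)$ with $f>0$ and all $t\ge0$, pointwise on $V$, $$\big|\nabla_R\sqrt{P_tf}\big|^2\le e^{-2Kt}\,P_t\big|\nabla_R\sqrt f\big|^2 .$$
   Context: A weighted graph $G=(V,w,m)$ consists of a vertex set $V$, symmetric edge weights $w:V\times V\to[0,\infty)$ and a vertex measure $m:V\to(0,\infty)$; the edges are the pairs of positive weight, and $x\sim y$ means $w(x,y)>0$. Locally finite means every vertex has finitely many neighbors. Simple graphs are the case $w\in\{0,1\}$, $m\equiv1$. $d(x,y)$ is the combinatorial (path) distance. Laplacian: $\Delta f(x)=\frac1{m(x)}\sum_y w(x,y)(f(y)-f(x))$. $P_t$ ($t\ge0$) denotes the heat semigroup generated by $\Delta$; for bounded $f:V\to\mathbb{R}$ it satisfies $\partial_tP_tf=\Delta P_tf$, $P_0f=f$. $R$-gradient: $|\nabla_R f|(x)=\max_{d(x,y)\le R}|f(y)-f(x)|$. Quadratic Gradient-Ollivier curvature: for $d(x,y)\le R$, $$K_R^q(x,y)=\frac12\inf\Big\{\Delta|\nabla_R g|^2(x)-\mathrm{sgn}(g(y)-g(x))\Big(\frac{\Delta g^2}{g}(y)-\frac{\Delta g^2}{g}(x)\Big)\Big\},$$ the infimum being over all $g:V\to(0,\infty)$ with $|\nabla_Rg|(x)=1$ and $|g(y)-g(x)|=1$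 (with $\inf\emptyset=+\infty$). Here $|\nabla_Rg|^2$ is the square of the function $|\nabla_R g|$. *)

(* Defs.v *)
From HB Require Import structures.
From mathcomp Require Import all_boot all_order all_algebra finmap.
From mathcomp Require Import all_classical all_reals all_analysis.
From mathcomp Require Import summability.

Set Implicit Arguments.
Unset Strict Implicit.
Unset Printing Implicit Defensive.

Import Order.TTheory GRing.Theory Num.Theory.
Import numFieldNormedType.Exports.

Local Open Scope classical_set_scope.
Local Open Scope ring_scope.

#[global] Existing Instance totally_filter.

Record weighted_graph (R : realType) (V : choiceType) := WeightedGraph {
  weight : V -> V -> R;
  vmeas : V -> R;
  weight_ge0 : forall x y, 0 <= weight x y;
  weight_sym : forall x y, weight x y = weight y x;
  vmeas_gt0 : forall x, 0 < vmeas x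
}.

Section WeightedGraphs.
Context {R : realType} {V : choiceType}.
Variable G : weighted_graph R V.

Definition neighbor (x y : V) : bool := 0 < weight G x y.

Definition locally_finite := forall x, finite_set [set y | neighbor x y].

(* The value is +oo when no path joins x to y. *)
Definition graph_dist (x y : V) : \bar R :=
  ereal_inf [set (size p)%:R%:E | p in [set p | path neighbor x p && (last x p == y)]].

(* On a locally finite graph only finitely many terms are nonzero (\sum over a
   classical set is the sum over the support). *)
Definition laplacian (f : V -> R) (x : V) : R :=
  (vmeas G x)^-1 * \sum_(y \in [set: V]) (weight G x y * (f y - f x)).

Definition restr (W : {fset V}) (f : V -> R) (x : V) : R :=
  if x \in W then f x else 0.

(* exp(t Delta_W) f, as an exponential series, where Delta_W is the Laplacian
   on the finite set W with Dirichlet boundary condition, acting on the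
   functions that vanish outside W. *)
Definition dirichlet_heat (W : {fset V}) (t : R) (f : V -> R) (x : V) : R :=
  limn (series (fun k : nat =>
    t ^+ k / k`!%:R * iter k (restr W \o laplacian) (restr W f) x)).

(* The (minimal) heat semigroup on bounded functions: the limit of the
   Dirichlet semigroups along the directed set of finite subsets of V. *)
Definition heat (t : R) (f : V -> R) (x : V) : R :=
  lim ((fun W : {fset V} => dirichlet_heat W t f x) @ totally).

(* On a locally finite graph the ball is finite and contains x, so that the
   supremum is a maximum. *)
Definition Rgrad (r : nat) (f : V -> R) (x : V) : R :=
  sup [set `|f y - f x| | y in [set y | (graph_dist x y <= r%:R%:E)%E]].

Definition Kq (r : nat) (x y : V) : \bar R :=
  ((2^-1)%:E * ereal_inf
    [set ((laplacian (fun z => Rgrad r g z ^+ 2) x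
           - Num.sg (g y - g x)
             * (laplacian (fun z => g z ^+ 2) y / g y
                - laplacian (fun z => g z ^+ 2) x / g x))%R)%:E
    | g in [set g : V -> R | [/\ forall z, (0 < g z)%R,
                                 Rgrad r g x = 1%R
                               & `|g y - g x|%R = 1%R]]])%E.

End WeightedGraphs.

(* Main.v *)
(** The curvature condition is the infinitesimal form of the gradient estimate:
    with g = sqrt (P_t f), the time derivative of (g y - g x)^2 is
    (g y - g x) (Delta(g^2)/g (y) - Delta(g^2)/g (x)).  Differentiating (ii) at
    t = 0, for f = g^2 with g made bounded away from x, gives (i).

    Conversely, (i) says that the R-gradient squared of sqrt (P_t f) is a
    subsolution of the equation du/dt = Delta u - 2 K u, and (ii) compares it
    with the solution exp (-2Kt) P_t |grad sqrt f|^2 by a maximum principle.  On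
    an infinite graph this needs a proper function phi with
    Delta phi <= lam phi.  It comes from (i) as well: applied to g = C + f with
    C large, (i) becomes a lower bound on a linear Ollivier curvature, hence a
    Laplacian comparison for the distance ceil (d(x0, .) / R). *)

Require Import Defs.
From mathcomp Require Import all_boot all_order all_algebra.
From mathcomp Require Import all_classical all_reals all_analysis.
From mathcomp Require Import finmap summability ring lra.
Import Order.TTheory GRing.Theory Num.Theory.
Import numFieldNormedType.Exports.
Set Implicit Arguments.
Unset Strict Implicit.
Unset Printing Implicit Defensive.
Local Open Scope classical_set_scope.
Local Open Scope ring_scope.

(** * Real analysis *)

Section RealLemmas.
Context {R : realType}.
Implicit Types (f df : R -> R) (t s u d e : R).

Lemma is_derive1_eps f t d : is_derive t 1 f d ->
  forall e, 0 < e -> exists2 del, 0 < del &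
    forall h, `|h| < del -> `|f (t + h) - f t - h * d| <= e * `|h|.
Proof.
move=> [/cvg_ex[/= l fl] fd] e e0.
have ld : l = d by rewrite -fd; apply/esym/cvg_lim.
rewrite ld in fl; move/cvgrPdist_le: fl => /(_ e e0).
move=> [del /= del0 H]; exists del => // h hd.
have [->|h0] := eqVneq h 0; first by rewrite addr0 subrr mul0r subr0 normr0 mulr0.
have := H h; rewrite /= sub0r normrN => /(_ hd h0).
rewrite [h%:A]mulr1 -[_ *: _]/(_ * _) (addrC h t) => H1.
have -> : f (t + h) - f t - h * d = - (h * (d - h^-1 * (f (t + h) - f t))).
  by field.
by rewrite normrN normrM mulrC ler_wpM2r.
Qed.

(** Quadratic error bounds survive pointwise limits, derivatives do not; differentiability of the
    heat semigroup is obtained in this form. *)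
Lemma is_derive1_quad f t d (C a : R) : 0 < a ->
  (forall h, `|h| < a -> `|f (t + h) - f t - h * d| <= C * h ^+ 2) ->
  is_derive t 1 f d.
Proof.
move=> a0 H.
have fl : (fun h => h^-1 *: (f (h *: (1:R) + t) - f t)) @ 0^' --> d.
  apply/cvgrPdist_le => e e0.
  have C1 : 0 < `|C| + 1 by rewrite ltr_wpDl.
  exists (Num.min a (e / (`|C| + 1))) => /= [|h].
    by rewrite lt_min a0 divr_gt0.
  rewrite /= sub0r normrN lt_min ltr_pdivlMr// => /andP[ha hd] h0.
  rewrite [h%:A]mulr1 -[_ *: _]/(_ * _) (addrC h t).
  have -> : d - h^-1 * (f (t + h) - f t) = - (h^-1 * (f (t + h) - f t - h * d)).
    by field.
  rewrite normrN normrM normfV mulrC ler_pdivrMr ?normr_gt0//.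
  apply: le_trans (H h ha) _.
  rewrite -real_normK ?num_real// expr2 mulrA ler_wpM2r//.
  apply: le_trans (ltW hd); rewrite mulrC ler_wpM2l//.
  by rewrite (le_trans (ler_norm _))// lerDl.
by apply: DeriveDef; [apply/cvg_ex; exists d | exact/cvg_lim].
Qed.

Lemma is_derive1_continuous f t d : is_derive t 1 f d -> {for t, continuous f}.
Proof. by move=> [fd _]; apply/differentiable_continuous/derivable1_diffP. Qed.

Lemma is_derive1_left_max f t d (a : R) : is_derive t 1 f d -> a < t ->
  (forall s, a < s -> s < t -> f s <= f t) -> 0 <= d.
Proof.
move=> fd at_ H; rewrite leNgt; apply/negP => d0.
(* With half the slope as tolerance, the error cannot cancel the first-order gain of a small step to
   the left. *)
have e0 : 0 < - d / 2 by rewrite divr_gt0// oppr_gt0.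
have [del del0 Hd] := is_derive1_eps fd e0.
pose h := Num.min (del / 2) ((t - a) / 2).
have h0 : 0 < h by rewrite lt_min !divr_gt0// subr_gt0.
have hdel : h < del.
  by rewrite gt_min; apply/orP; left; rewrite ltr_pdivrMr// ltr_pMr// ltr1n.
have hta : h <= (t - a) / 2 by rewrite ge_min lexx orbT.
have := Hd (- h); rewrite normrN gtr0_norm// => /(_ hdel).
have := H (t - h).
have -> : a < t - h by lra.
have -> : t - h < t by lra.
move=> /(_ isT isT) H1; rewrite ler_norml => /andP[H2 _]; nra.
Qed.

Lemma is_derive1_right_min f t d : is_derive t 1 f d ->
  (forall s, t < s -> f t <= f s) -> 0 <= d.
Proof.
move=> fd H; rewrite leNgt; apply/negP => d0.
have e0 : 0 < - d / 2 by rewrite divr_gt0// oppr_gt0.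
have [del del0 Hd] := is_derive1_eps fd e0.
have := Hd (del / 2); rewrite gtr0_norm ?divr_gt0//.
have -> : del / 2 < del by rewrite ltr_pdivrMr// ltr_pMr// ltr1n.
have := H (t + del / 2); rewrite ltrDl divr_gt0// => /(_ isT) H1 /(_ isT).
rewrite ler_norml => /andP[_ H2]; nra.
Qed.

Lemma seq_argmax (T : eqType) (s : seq T) (F : T -> R) : s != [::] ->
  exists2 i, i \in s & forall j, j \in s -> F j <= F i.
Proof.
elim: s => // a [|b s] IH _.
  by exists a => [|j]; rewrite inE// => /eqP->.
have [//|i iin Hi] := IH _.
have [ai|ia] := leP (F a) (F i).
  exists i => [|j]; first by rewrite inE iin orbT.
  by rewrite inE => /predU1P[->//|/Hi].
exists a => [|j]; first by rewrite inE eqxx.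
by rewrite inE => /predU1P[->//|/Hi/le_trans]; apply; exact: ltW.
Qed.

(* At a point where the largest of the [F i] is maximal over [0, T], the left
   derivative of the maximizing [F i] is nonnegative. *)
Lemma finite_family_max_principle (T : eqType) (s : seq T) (F : T -> R -> R) (T0 : R) :
  (forall i, i \in s -> continuous (F i)) ->
  (forall i, i \in s -> F i 0 <= 0) ->
  (forall i t, i \in s -> 0 < t -> t <= T0 -> 0 < F i t ->
    (forall j, j \in s -> F j t <= F i t) ->
    exists2 d, is_derive t 1 (F i) d & d < 0) ->
  forall i t, i \in s -> 0 <= t -> t <= T0 -> F i t <= 0.
Proof.
move=> Fc F0 Fd i0 t0 i0s t00 t0T.
have T00 : 0 <= T0 by exact: le_trans t0T.
have /choice[c cP] (i : T) : exists ci, i \in s -> (ci \in `[0, T0]) /\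
    (forall t, t \in `[0, T0] -> F i t <= F i ci).
  case: (boolP (i \in s)) => [ins|_]; last by exists 0.
  have [ci ci1 ci2] := EVT_max T00 (continuous_subspaceT (Fc i ins)).
  by exists ci.
(* The index whose maximum over [[0, T0]] is largest: its maximizer [c i] is then maximal over all
   indices and all times at once. *)
have [|i is_ imax] := @seq_argmax _ s (fun i => F i (c i)); first by case: (s) i0s.
have [ci1 ci2] := cP _ is_.
have H j t : j \in s -> t \in `[0, T0] -> F j t <= F i (c i).
  by move=> js tI; apply: le_trans (imax j js); have [_] := cP _ js; exact.
apply: le_trans (H _ t0 i0s _) _; first by rewrite in_itv/= t00.
rewrite leNgt; apply/negP => pos.
move: (ci1); rewrite in_itv/= => /andP[]; rewrite le_eqVlt => /predU1P[c0|c0] cT.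
  by move: pos; rewrite -c0 ltNge F0.
have [d dd] := Fd i (c i) is_ c0 cT pos (fun j js => H j (c i) js ci1).
apply/negP; rewrite -leNgt; apply: is_derive1_left_max dd c0 _ => u u0 uc.
by apply: ci2; rewrite in_itv/= !ltW// (lt_le_trans uc).
Qed.

(** Both orders of [t] and [s] are covered, and [c] stays in the half-line [0 <= c], the only place
    where the bounds on the semigroups hold. *)
Lemma mean_value f df t s : (forall u, 0 <= u -> is_derive u 1 f (df u)) ->
  0 <= t -> 0 <= s ->
  exists2 c, 0 <= c /\ `|c - t| <= `|s - t| & f s - f t = df c * (s - t).
Proof.
move=> fd t0 s0.
have mvt (a b : R) : 0 <= a -> a <= b ->
    exists2 c, a <= c <= b & f b - f a = df c * (b - a).
  move=> a0 ab.
  have [u uI||c cI E] := @MVT_segment _ f df _ _ ab.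
  - by apply: fd; rewrite (le_trans a0)// ltW// (itvP uI).
  - apply: continuous_in_subspaceT => u.
    move=> /set_mem; rewrite /= in_itv/= => /andP[au _].
    exact: is_derive1_continuous (fd u (le_trans a0 au)).
  - by exists c => //; move: cI; rewrite in_itv.
have [ts|/ltW st] := leP t s.
  have [c /andP[c1 c2] E] := mvt _ _ t0 ts.
  exists c => //; split; first exact: le_trans c1.
  by rewrite !ger0_norm ?subr_ge0// lerB.
have [c /andP[c1 c2] E] := mvt _ _ s0 st.
exists c; last by rewrite -opprB E -mulrN opprB.
split; first exact: le_trans c1.
by rewrite !(distrC _ t) !ger0_norm ?subr_ge0// lerB.
Qed.

End RealLemmas.

(** * Laplacian, balls and gradients *)

Section LocalAnalysis.
Context {R : realType} {V : choiceType} (G : weighted_graph R V).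
Hypothesis lfG : locally_finite G.
Implicit Types (f g : V -> R) (x y z : V) (n : nat).

Definition nbhd x : seq V := fset_set [set y | neighbor G x y].

Lemma mem_nbhd x y : (y \in nbhd x) = neighbor G x y.
Proof. rewrite /nbhd in_fset_set; last exact: lfG.
by apply/idP/idP => [/set_mem|/mem_set]. Qed.

Lemma laplacianE f x :
  laplacian G f x =
  (vmeas G x)^-1 * \sum_(y <- nbhd x) weight G x y * (f y - f x).
Proof.
rewrite /laplacian; congr (_ * _); rewrite -fsbig_finite//.
apply/esym/fsbig_widen => // y [_ /= /negP].
rewrite /neighbor -leNgt => w0.
have -> : weight G x y = 0 by apply/eqP; rewrite eq_le w0 weight_ge0.
by rewrite mul0r.
Qed.

Lemma eq_laplacian f g x : f x = g x ->
  (forall y, neighbor G x y -> f y = g y) -> laplacian G f x = laplacian G g x.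
Proof.
move=> fgx fg; rewrite !laplacianE; congr (_ * _); apply: eq_big_seq => y.
by rewrite mem_nbhd => /fg ->; rewrite fgx.
Qed.

Lemma laplacianD f g x :
  laplacian G (fun z => f z + g z) x = laplacian G f x + laplacian G g x.
Proof.
rewrite !laplacianE -mulrDr -big_split/=; congr (_ * _).
by apply: eq_bigr => y _ /=; ring.
Qed.

Lemma laplacianZ (a : R) f x :
  laplacian G (fun z => a * f z) x = a * laplacian G f x.
Proof.
rewrite !laplacianE mulrCA [in RHS]mulr_sumr; congr (_ * _).
by apply: eq_bigr => y _ /=; ring.
Qed.

Lemma laplacian_cst (a : R) x : laplacian G (fun=> a) x = 0.
Proof. by rewrite laplacianE big1 ?mulr0// => y _; rewrite subrr mulr0. Qed.

Lemma laplacianN f x : laplacian G (fun z => - f z) x = - laplacian G f x.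
Proof.
rewrite -mulN1r -laplacianZ; congr (laplacian G _ x).
by apply/funext => z; rewrite mulN1r.
Qed.

Lemma laplacianB f g x :
  laplacian G (fun z => f z - g z) x = laplacian G f x - laplacian G g x.
Proof. by rewrite laplacianD laplacianN. Qed.

Lemma laplacian_max_le0 f x :
  (forall y, neighbor G x y -> f y <= f x) -> laplacian G f x <= 0.
Proof.
move=> fx; rewrite laplacianE pmulr_rle0 ?invr_gt0 ?vmeas_gt0//.
rewrite big_seq; apply: sumr_le0 => y; rewrite mem_nbhd => /fx fyx.
by rewrite mulr_ge0_le0 ?weight_ge0// subr_le0.
Qed.

Lemma cvg_laplacian (T : Type) (F : set_system T) (FF : Filter F)
    (u : T -> V -> R) f x :
  (forall y, u t y @[t --> F] --> f y) ->
  laplacian G (u t) x @[t --> F] --> laplacian G f x.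
Proof.
move=> uf; rewrite laplacianE.
under eq_fun do rewrite laplacianE.
apply: cvgMr; elim: (nbhd x) => [|y s IH].
  by rewrite big_nil; under eq_fun do rewrite big_nil; exact: cvg_cst.
rewrite big_cons; under eq_fun do rewrite big_cons.
by apply: cvgD => //; apply: cvgMr; exact: cvgB.
Qed.

(** The weighted degree; [2 * vdeg x] bounds the Laplacian at [x] of functions of sup norm at most
    one. *)
Definition vdeg x : R := (vmeas G x)^-1 * \sum_(y <- nbhd x) weight G x y.

Lemma vdeg_ge0 x : 0 <= vdeg x.
Proof.
by rewrite mulr_ge0 ?invr_ge0 ?(ltW (vmeas_gt0 _ _))// sumr_ge0// => *; exact: weight_ge0.
Qed.

(** The bound [C] varies with the vertex because it is applied to time increments, whose Lipschitz
    constants depend on the degree. *)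
Lemma laplacian_lip_le (C : V -> R) f x : (forall y, `|f y| <= C y) ->
  `|laplacian G f x| <=
    (vmeas G x)^-1 * \sum_(y <- nbhd x) weight G x y * (C y + C x).
Proof.
move=> fC; rewrite laplacianE normrM ger0_norm ?invr_ge0 ?(ltW (vmeas_gt0 _ _))//.
rewrite ler_wpM2l ?invr_ge0 ?(ltW (vmeas_gt0 _ _))//.
apply: le_trans (ler_norm_sum _ _ _) _; apply: ler_sum => y _.
rewrite normrM ger0_norm ?weight_ge0// ler_wpM2l ?weight_ge0//.
by rewrite (le_trans (ler_normB _ _))// lerD.
Qed.

Lemma laplacian_norm_le f (M : R) x :
  (forall y, `|f y| <= M) -> `|laplacian G f x| <= 2 * vdeg x * M.
Proof.
move=> fM; apply: le_trans (laplacian_lip_le x fM) _.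
by rewrite -mulr_suml mulrA -/(vdeg x); nra.
Qed.

(** The ball as an explicit list, so that maxima over it are attained; repetitions are harmless. *)
Fixpoint ball_seq n x : seq V :=
  if n is n'.+1 then x :: flatten [seq ball_seq n' z | z <- nbhd x] else [:: x].

Lemma ball_seqP n x y : reflect
  (exists p, [/\ path (neighbor G) x p, last x p = y & (size p <= n)%N])
  (y \in ball_seq n x).
Proof.
elim: n x y => [|n IH] x y /=.
  rewrite inE; apply: (iffP eqP) => [->|[[|z p] []//]].
  by exists [::].
rewrite inE; apply: (iffP orP) => [[/eqP->|/flattenP[_ /mapP[z zx ->]]]|].
- by exists [::].
- move=> /IH[p [pp lp sp]]; exists (z :: p); split=> //=.
  by rewrite -mem_nbhd zx.
- move=> [[|z p] [/= pp <- sp]]; first by left.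
  case/andP: pp => xz pp; right; apply/flattenP; exists (ball_seq n z).
    by apply/mapP; exists z => //; rewrite mem_nbhd.
  by apply/IH; exists p.
Qed.

Lemma graph_dist_leP n x y :
  (graph_dist G x y <= n%:R%:E)%E <-> y \in ball_seq n x.
Proof.
split=> [d|/ball_seqP[p [pp lp sp]]]; last first.
  apply: le_trans (_ : (size p)%:R%:E <= _)%E; last by rewrite lee_fin ler_nat.
  by apply: ereal_inf_lbound; exists p => //=; rewrite pp lp eqxx.
(* A strict bound on the infimum yields an actual path, and its integer length, being below [n + 1],
   is at most [n]. *)
have : (graph_dist G x y < n.+1%:R%:E)%E.
  by apply: le_lt_trans d _; rewrite lte_fin ltr_nat.
move=> /ereal_inf_lt[_ [p /andP[pp /eqP lp] <-]].
by rewrite lte_fin ltr_nat ltnS => sp; apply/ball_seqP; exists p.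
Qed.

Lemma ball_seq_refl n x : x \in ball_seq n x.
Proof. by apply/ball_seqP; exists [::]. Qed.

Lemma neighbor_sym x y : neighbor G x y = neighbor G y x.
Proof. by rewrite /neighbor weight_sym. Qed.

Lemma ball_seq_sym n x y : (y \in ball_seq n x) = (x \in ball_seq n y).
Proof.
suff H a b : b \in ball_seq n a -> a \in ball_seq n b by apply/idP/idP; exact: H.
move=> /ball_seqP[p [pp <- sp]]; apply/ball_seqP; exists (rev (belast a p)).
rewrite rev_path size_rev size_belast; split=> //.
  by rewrite (eq_path (e' := neighbor G))// => u v; exact: neighbor_sym.
by case: p {pp sp} => //= c p; rewrite rev_cons last_rcons.
Qed.

Lemma ball_seq_trans m n x y z :
  y \in ball_seq m x -> z \in ball_seq n y -> z \in ball_seq (m + n) x.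
Proof.
move=> /ball_seqP[p [pp lp sp]] /ball_seqP[q [pq lq sq]]; apply/ball_seqP.
exists (p ++ q); rewrite cat_path pp lp pq last_cat lp lq size_cat.
by split=> //; exact: leq_add.
Qed.

Lemma ball_seq_split m n x z : z \in ball_seq (m + n) x ->
  exists2 y, y \in ball_seq m x & z \in ball_seq n y.
Proof.
move=> /ball_seqP[p [pp lp sp]].
move: pp lp; rewrite -{1 2}(cat_take_drop m p) cat_path last_cat => /andP[p1 p2] lp.
exists (last x (take m p)); apply/ball_seqP.
  by exists (take m p); split=> //; rewrite size_take_min geq_minl.
by exists (drop m p); split=> //; rewrite size_drop leq_subLR.
Qed.

Lemma ball_seq_le m n x y : (m <= n)%N -> y \in ball_seq m x -> y \in ball_seq n x.
Proof.
move=> mn /ball_seqP[p [pp lp sp]]; apply/ball_seqP.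
by exists p; split=> //; exact: leq_trans mn.
Qed.

Lemma neighbor_ball_seq n x y : (0 < n)%N -> neighbor G x y -> y \in ball_seq n x.
Proof. by move=> n0 xy; apply/ball_seqP; exists [:: y]; rewrite /= xy. Qed.

(** * The R-gradient as a maximum over a finite ball *)

Lemma Rgrad_attained n f x :
  exists2 y, y \in ball_seq n x &
    Rgrad G n f x = `|f y - f x| /\
    (forall z, z \in ball_seq n x -> `|f z - f x| <= `|f y - f x|).
Proof.
have [|y yB ymax] := @seq_argmax _ _ (ball_seq n x) (fun y => `|f y - f x|).
  by case: n.
exists y => //; split=> //; apply/eqP; rewrite eq_le; apply/andP; split.
  apply: ge_sup; first by exists `|f y - f x|, y => //; apply/graph_dist_leP.
  by move=> _ [z /graph_dist_leP zB <-]; exact: ymax.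
apply: ub_le_sup; last by exists y => //; apply/graph_dist_leP.
by exists `|f y - f x| => _ [z /graph_dist_leP zB <-]; exact: ymax.
Qed.

Lemma Rgrad_ub n f x y : y \in ball_seq n x -> `|f y - f x| <= Rgrad G n f x.
Proof. by have [z zB [-> H]] := Rgrad_attained n f x; exact: H. Qed.

Lemma Rgrad_le n f x (a : R) :
  (forall y, y \in ball_seq n x -> `|f y - f x| <= a) -> Rgrad G n f x <= a.
Proof. by have [z zB [-> H]] := Rgrad_attained n f x; exact. Qed.

Lemma Rgrad_ge0 n f x : 0 <= Rgrad G n f x.
Proof. by have [y _ [-> _]] := Rgrad_attained n f x. Qed.

Lemma eq_Rgrad n f g x : (forall y, y \in ball_seq n x -> f y = g y) ->
  Rgrad G n f x = Rgrad G n g x.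
Proof.
move=> fg; have fgx := fg _ (ball_seq_refl n x).
apply/eqP; rewrite eq_le; apply/andP; split; apply: Rgrad_le => y yB.
  by rewrite fg// fgx; exact: Rgrad_ub.
by rewrite -fg// -fgx; exact: Rgrad_ub.
Qed.

Lemma Rgrad_scale n f x (a : R) : 0 <= a ->
  Rgrad G n (fun z => a * f z) x = a * Rgrad G n f x.
Proof.
move=> a0; have [y yB [-> H]] := Rgrad_attained n f x.
have E z : `|a * f z - a * f x| = a * `|f z - f x|.
  by rewrite -mulrBr normrM ger0_norm.
apply/eqP; rewrite eq_le; apply/andP; split.
  by apply: Rgrad_le => z zB; rewrite E ler_wpM2l// H.
by rewrite -E; exact: (@Rgrad_ub _ (fun z => a * f z)).
Qed.

Lemma Rgrad_sqrt_bound n f (M : R) x : (forall y, 0 <= f y <= M) ->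
  0 <= Rgrad G n (fun z => Num.sqrt (f z)) x ^+ 2 <= M.
Proof.
move=> fM; rewrite sqr_ge0/=.
have M0 : 0 <= M by have /andP[/le_trans] := fM x; exact.
rewrite -[leRHS]sqr_sqrtr// lerXn2r ?nnegrE ?sqrtr_ge0 ?Rgrad_ge0//.
apply: Rgrad_le => y _.
have H z : 0 <= Num.sqrt (f z) <= Num.sqrt M.
  by have /andP[_ fzM] := fM z; rewrite sqrtr_ge0 ler_wsqrtr.
have /andP[a1 a2] := H x; have /andP[b1 b2] := H y.
by rewrite ler_norml; apply/andP; split; lra.
Qed.

End LocalAnalysis.

(** * Dirichlet semigroups *)

Section DirichletSemigroup.
Context {R : realType} {V : choiceType} (G : weighted_graph R V).
Hypothesis lfG : locally_finite G.
Implicit Types (f g : V -> R) (x y z : V) (n k : nat) (t s : R) (W : {fset V}).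

Lemma restr_in W f x : x \in W -> restr W f x = f x.
Proof. by rewrite /restr => ->. Qed.

Lemma restr_out W f x : x \notin W -> restr W f x = 0.
Proof. by rewrite /restr => /negPf ->. Qed.

Let L W := restr W \o laplacian G.

(** A crude bound, with a sum in place of a maximum, for the norm of [L W] on bounded functions;
    only its finiteness matters, for the convergence of the exponential series. *)
Definition deg_bound W : R := 2 * \sum_(x <- W) vdeg G x.

Lemma deg_bound_ge0 W : 0 <= deg_bound W.
Proof. by rewrite mulr_ge0// sumr_ge0// => x _; exact: vdeg_ge0. Qed.

Lemma le_sum_fset W (u : V -> R) x : (forall y, 0 <= u y) -> x \in W ->
  u x <= \sum_(y <- W) u y.
Proof. by move=> u0 xW; rewrite (big_fsetD1 x)//= lerDl sumr_ge0. Qed.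

Lemma iter_dirichlet_bound W g (M : R) n x : (forall y, `|g y| <= M) ->
  `|iter n (L W) g x| <= deg_bound W ^+ n * M.
Proof.
move=> gM; elim: n x => [|n IH] x; first by rewrite expr0 mul1r.
rewrite iterS /L /=; have [xW|xW] := boolP (x \in W); last first.
  rewrite restr_out// normr0 mulr_ge0// ?exprn_ge0 ?deg_bound_ge0//.
  exact: le_trans (gM x).
rewrite restr_in// exprS -mulrA; apply: le_trans (laplacian_norm_le lfG x IH) _.
rewrite ler_wpM2r//.
  by rewrite mulr_ge0 ?exprn_ge0 ?deg_bound_ge0// (le_trans _ (gM x)).
by rewrite /deg_bound ler_wpM2l// le_sum_fset// => y; exact: vdeg_ge0.
Qed.

Definition exp_dirichlet_coeff W g x n : R := n`!%:R^-1 * iter n (L W) g x.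

Lemma is_cvg_exp_dirichlet W g (M : R) x t : (forall y, `|g y| <= M) ->
  cvgn (pseries (exp_dirichlet_coeff W g x) t).
Proof.
move=> gM; apply: normed_cvg.
apply: (@series_le_cvg _ _ (M *: exp_coeff (deg_bound W * `|t|))).
- by move=> n /=.
- move=> n /=; rewrite mulr_ge0//; first by rewrite (le_trans _ (gM x)).
  by rewrite /exp_coeff/= divr_ge0// exprn_ge0// mulr_ge0// deg_bound_ge0.
- move=> n; rewrite /exp_dirichlet_coeff/= !normrM normfV normr_nat normrX.
  apply: (@le_trans _ _ (n`!%:R^-1 * (deg_bound W ^+ n * M) * `|t| ^+ n)).
    rewrite ler_wpM2r ?exprn_ge0// ler_wpM2l ?invr_ge0//.
    exact: iter_dirichlet_bound.
  rewrite le_eqVlt; apply/orP; left; apply/eqP.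
  rewrite -[RHS]/(M * ((deg_bound W * `|t|) ^+ n / n`!%:R)) (exprMn n (deg_bound W)).
  by move: (deg_bound W ^+ n) (`|t| ^+ n) (n`!%:R^-1) => a b c; ring.
- exact/is_cvg_seriesZ/is_cvg_series_exp_coeff.
Qed.

(** Termwise differentiation shifts the coefficients of the exponential, which amounts to replacing
    [g] by [L W g]. *)
Lemma pseries_diffs_exp_dirichlet W g x :
  pseries_diffs (exp_dirichlet_coeff W g x) = exp_dirichlet_coeff W (L W g) x.
Proof.
apply/funext => n; rewrite /pseries_diffs /exp_dirichlet_coeff -iterSr.
by rewrite factS natrM invfM mulrA mulrA mulfV ?mul1r.
Qed.

Lemma is_derive_exp_dirichlet W g (M : R) x t : (forall y, `|g y| <= M) ->
  is_derive t 1 (fun t => limn (pseries (exp_dirichlet_coeff W g x) t))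
    (limn (pseries (exp_dirichlet_coeff W (L W g) x) t)).
Proof.
move=> gM.
have LgM : forall y, `|L W g y| <= deg_bound W * M.
  by move=> y; have := @iter_dirichlet_bound W g M 1 y gM; rewrite expr1.
have LLgM : forall y, `|L W (L W g) y| <= deg_bound W ^+ 2 * M.
  by move=> y; have := @iter_dirichlet_bound W g M 2 y gM.
rewrite -pseries_diffs_exp_dirichlet.
(* Termwise differentiation at [t] requires the series and its first two formal derivatives to
   converge at a point of larger modulus, here [|t| + 1]. *)
apply: (@pseries_snd_diffs _ _ (`|t| + 1)); rewrite ?pseries_diffs_exp_dirichlet.
- exact: is_cvg_exp_dirichlet gM.
- exact: is_cvg_exp_dirichlet LgM.
- exact: is_cvg_exp_dirichlet LLgM.
- by rewrite [ltRHS]ger0_norm ?ltrDl// addr_ge0.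
Qed.

(** [L W] is linear, so it commutes with the partial sums, and it involves finitely many values, so
    it passes to their limit. *)
Lemma exp_dirichlet_generator W g (M : R) x t : (forall y, `|g y| <= M) ->
  limn (pseries (exp_dirichlet_coeff W (L W g) x) t) =
  L W (fun y => limn (pseries (exp_dirichlet_coeff W g y) t)) x.
Proof.
move=> gM; apply: cvg_lim => //.
have psE : pseries (exp_dirichlet_coeff W (L W g) x) t =
    (fun n => L W (fun y => pseries (exp_dirichlet_coeff W g y) t n) x).
  apply/funext => n; rewrite /pseries /series /= /restr.
  elim: n => [|n IH].
    have -> : (fun y => \sum_(0 <= k < 0) exp_dirichlet_coeff W g y k * t ^+ k) =
        fun=> 0 by apply/funext => y; rewrite big_geq.
    by rewrite big_geq// /L /= /restr laplacian_cst// if_same.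
  have -> : (fun y => \sum_(0 <= k < n.+1) exp_dirichlet_coeff W g y k * t ^+ k) =
      fun y => \sum_(0 <= k < n) exp_dirichlet_coeff W g y k * t ^+ k +
        (n`!%:R^-1 * t ^+ n) * iter n (L W) g y.
    by apply/funext => y; rewrite big_nat_recr//= [in RHS]mulrAC.
  have E : exp_dirichlet_coeff W (L W g) x n =
      n`!%:R^-1 * (if x \in W then laplacian G (iter n (L W) g) x else 0).
    by rewrite /exp_dirichlet_coeff -iterSr.
  rewrite big_nat_recr//= IH {}E /L/= /restr laplacianD// laplacianZ//.
  by case: ifP => _; rewrite ?mulr0 ?mul0r ?addr0// mulrAC.
rewrite psE /L/= /restr; case: ifP => _; last exact: cvg_cst.
by apply: cvg_laplacian => // y; exact: is_cvg_exp_dirichlet gM.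
Qed.

Lemma dirichlet_heatE W t f x :
  dirichlet_heat G W t f x =
  limn (pseries (exp_dirichlet_coeff W (restr W f) x) t).
Proof.
rewrite /dirichlet_heat /pseries; congr (limn (series _)); apply/funext => n.
by rewrite /exp_dirichlet_coeff [RHS]mulrC mulrA.
Qed.

Lemma restr_bound W f x : `|restr W f x| <= \sum_(y <- W) `|f y|.
Proof.
rewrite /restr; case: ifP => [xW|_]; first exact: (@le_sum_fset _ (fun y => `|f y|)).
by rewrite normr0 sumr_ge0.
Qed.

Lemma is_derive_dirichlet_heat W f x t :
  is_derive t 1 (fun t => dirichlet_heat G W t f x)
    (restr W (laplacian G (dirichlet_heat G W t f)) x).
Proof.
have -> : restr W (laplacian G (dirichlet_heat G W t f)) x =
    limn (pseries (exp_dirichlet_coeff W (L W (restr W f)) x) t).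
  rewrite (exp_dirichlet_generator _ _ _ (restr_bound W f)) /L/=.
  by congr (restr W (laplacian G _) x); apply/funext => y; rewrite dirichlet_heatE.
under eq_fun do rewrite dirichlet_heatE.
exact: is_derive_exp_dirichlet (restr_bound W f).
Qed.

Lemma dirichlet_heat0 W f x : dirichlet_heat G W 0 f x = restr W f x.
Proof.
rewrite dirichlet_heatE; apply: cvg_lim => //.
rewrite -(cvg_shiftS _); apply: cvg_near_cst; near=> n.
rewrite /pseries /series/= big_nat_recl//= big1 ?addr0.
  by rewrite /exp_dirichlet_coeff/= fact0 invr1 !mul1r expr0 mulr1.
by move=> i _; rewrite expr0n mulr0.
Unshelve. all: by end_near. Qed.

Lemma dirichlet_heat_out W t f x : x \notin W -> dirichlet_heat G W t f x = 0.
Proof.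
move=> xW; rewrite dirichlet_heatE; apply: cvg_lim => //.
apply: cvg_near_cst; near=> n.
rewrite /pseries /series/= big1// => -[|i] _; rewrite /exp_dirichlet_coeff.
  by rewrite /= restr_out// mulr0 mul0r.
by rewrite iterS /L/= restr_out// mulr0 mul0r.
Unshelve. all: by end_near. Qed.

End DirichletSemigroup.

(** * The heat semigroup *)

Section HeatSemigroup.
Context {R : realType} {V : choiceType} (G : weighted_graph R V).
Hypothesis lfG : locally_finite G.
Implicit Types (f g : V -> R) (x y z : V) (t s M : R) (W : {fset V}).

Lemma is_derive_expRM (a t : R) :
  is_derive t 1 (fun t => expR (a * t)) (a * expR (a * t)).
Proof.
have -> : (fun t => expR (a * t)) = expR \o (fun t => a * t) by [].
rewrite mulrC; apply: is_derive1_comp.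
by apply: is_derive_eq; rewrite -[LHS]/(a * 1) mulr1.
Qed.

Lemma is_derive_realM (u v : R -> R) (t du dv : R) :
  is_derive t 1 u du -> is_derive t 1 v dv ->
  is_derive t 1 (fun t => u t * v t) (u t * dv + v t * du).
Proof. by move=> ud vd; exact: (is_deriveM ud vd). Qed.

(** The factor [expR (- t)] makes the inequality strict: at a negative minimum the Laplacian is
    nonnegative, and the damping adds a term [- u > 0] to the derivative. *)
Lemma dirichlet_min_principle W (u du : R -> V -> R) :
  (forall x t, x \in W -> is_derive t 1 (u^~ x) (du t x)) ->
  (forall x t, x \in W -> 0 < t -> laplacian G (u t) x <= du t x) ->
  (forall x, x \in W -> 0 <= u 0 x) ->
  (forall x t, x \notin W -> 0 <= t -> 0 <= u t x) ->
  forall x t, 0 <= t -> 0 <= u t x.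
Proof.
move=> ud usup u0 uout x0 t0 t00.
have [x0W|x0W] := boolP (x0 \in W); last exact: uout.
pose F x t := - (expR (- 1 * t) * u t x).
have Fd x t : x \in W -> is_derive t 1 (F x)
    (- (expR (- 1 * t) * du t x + u t x * (- 1 * expR (- 1 * t)))).
  move=> xW; apply: is_deriveN; apply: is_derive_realM; first exact: is_derive_expRM.
  exact: ud.
suff : F x0 t0 <= 0 by rewrite /F oppr_le0 pmulr_rge0// expR_gt0.
apply: (@finite_family_max_principle _ _ W F t0) => //.
- by move=> x xW t; exact: is_derive1_continuous (Fd x t xW).
- by move=> x xW; rewrite /F mulr0 expR0 mul1r oppr_le0 u0.
move=> x t xW t_gt0 _ Fpos Fmax; eexists; first exact: Fd.
have e0 := expR_gt0 (- 1 * t).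
have ux : u t x < 0 by move: Fpos; rewrite /F oppr_gt0 pmulr_rlt0.
have : 0 <= laplacian G (u t) x.
  rewrite -oppr_le0 -laplacianN//; apply: laplacian_max_le0 => // y _.
  have [yW|yW] := boolP (y \in W).
    by have := Fmax y yW; rewrite /F !lerN2 ler_pM2l.
  (* A neighbor outside [W] has a nonnegative value, so it does not lie below the negative value at
     [x]. *)
  by rewrite lerN2 (le_trans (ltW ux))// uout// ltW.
have := usup x t xW t_gt0; nra.
Qed.

Lemma dirichlet_heat_ge0 W f x t : (forall y, 0 <= f y) -> 0 <= t ->
  0 <= dirichlet_heat G W t f x.
Proof.
move=> f0 t0.
apply: (@dirichlet_min_principle W (fun t => dirichlet_heat G W t f)
  (fun t => restr W (laplacian G (dirichlet_heat G W t f)))) => //.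
- by move=> y s yW; exact: is_derive_dirichlet_heat.
- by move=> y s yW _; rewrite restr_in.
- by move=> y yW; rewrite dirichlet_heat0 restr_in.
- by move=> y s yW _; rewrite dirichlet_heat_out.
Qed.

Lemma dirichlet_heat_le W f x t M : 0 <= M -> (forall y, f y <= M) -> 0 <= t ->
  dirichlet_heat G W t f x <= M.
Proof.
move=> M0 fM t0; rewrite -subr_ge0.
apply: (@dirichlet_min_principle W (fun t x => M - dirichlet_heat G W t f x)
  (fun t x => - restr W (laplacian G (dirichlet_heat G W t f)) x)) => //.
- move=> y s yW; rewrite -[- _]add0r; apply: is_deriveB.
  exact: is_derive_dirichlet_heat.
- by move=> y s yW _; rewrite restr_in// laplacianB// laplacian_cst// sub0r.
- by move=> y yW; rewrite dirichlet_heat0 restr_in// subr_ge0.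
- by move=> y s yW _; rewrite dirichlet_heat_out// subr0.
Qed.

(** On [W] the difference solves the heat equation with zero initial value; outside [W] the smaller
    solution vanishes and the larger one is nonnegative. *)
Lemma dirichlet_heat_mono W W' f x t : (W `<=` W')%fset ->
  (forall y, 0 <= f y) -> 0 <= t ->
  dirichlet_heat G W t f x <= dirichlet_heat G W' t f x.
Proof.
move=> WW' f0 t0; rewrite -subr_ge0.
apply: (@dirichlet_min_principle W
  (fun t x => dirichlet_heat G W' t f x - dirichlet_heat G W t f x)
  (fun t x => restr W' (laplacian G (dirichlet_heat G W' t f)) x -
              restr W (laplacian G (dirichlet_heat G W t f)) x)) => //.
- by move=> y s yW; apply: is_deriveB; exact: is_derive_dirichlet_heat.
- move=> y s yW _; rewrite !restr_in// ?laplacianB//.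
  exact: (fsubsetP WW').
- move=> y yW; rewrite !dirichlet_heat0 !restr_in// ?subrr//.
  exact: (fsubsetP WW').
- move=> y s yW s0; rewrite (dirichlet_heat_out _ _ _ yW)// subr0.
  exact: dirichlet_heat_ge0.
Qed.

(** Serves strict positivity of the heat flow: killing whatever leaves [x] loses mass at rate at
    most [vdeg G x]. *)
Lemma dirichlet_heat1_lower f x t : (forall y, 0 <= f y) -> 0 <= t ->
  expR (- (vdeg G x * t)) * f x <= dirichlet_heat G [fset x]%fset t f x.
Proof.
move=> f0 t0; set W := [fset x]%fset; set D := vdeg G x.
have xW : x \in W by rewrite inE.
pose u t := expR (D * t) * dirichlet_heat G W t f x.
have ud s : is_derive s 1 u (expR (D * s) *
    restr W (laplacian G (dirichlet_heat G W s f)) x +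
    dirichlet_heat G W s f x * (D * expR (D * s))).
  apply: is_derive_realM; first exact: is_derive_expRM.
  exact: is_derive_dirichlet_heat.
have [c [c0 _]] := mean_value (fun s _ => ud s) (lexx 0) t0.
rewrite subr0 restr_in// => /eqP; rewrite subr_eq => /eqP.
rewrite /u mulr0 expR0 mul1r dirichlet_heat0 restr_in// => E.
rewrite expRN ler_pdivrMl ?expR_gt0// E lerDr mulr_ge0//.
(* Here [A + D * h] is the gain term of the Laplacian alone, a weighted sum of nonnegative
   values. *)
have -> (A h : R) : expR (D * c) * A + h * (D * expR (D * c)) =
    expR (D * c) * (A + D * h) by ring.
rewrite mulr_ge0 ?expR_ge0//.
rewrite laplacianE// /D /vdeg -mulrA -mulrDr.
rewrite mulr_ge0 ?invr_ge0 ?(ltW (vmeas_gt0 _ _))// mulr_suml -big_split/=.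
apply: sumr_ge0 => y _; rewrite -mulrDr subrK mulr_ge0 ?weight_ge0//.
exact: dirichlet_heat_ge0.
Qed.

(** * Passage to the limit over finite vertex sets *)

Section Bounded.
Variables (f : V -> R) (M : R).
Hypothesis fM : forall y, 0 <= f y <= M.

Let f_ge0 y : 0 <= f y. Proof. by have /andP[] := fM y. Qed.
Let f_leM y : f y <= M. Proof. by have /andP[] := fM y. Qed.

(** The Dirichlet solutions increase with [W] and are bounded by [M], so they converge to their
    supremum. *)
Lemma heat_cvg t x : 0 <= t ->
  dirichlet_heat G W t f x @[W --> totally] --> heat G t f x.
Proof.
move=> t0; have M0 : 0 <= M by exact: le_trans (f_ge0 x) (f_leM x).
pose S := [set dirichlet_heat G W t f x | W in [set: {fset V}]].
have S0 : S !=set0 by exists (dirichlet_heat G fset0 t f x), fset0.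
have Sub : ubound S M by move=> _ [W _ <-]; exact: dirichlet_heat_le.
suff H : dirichlet_heat G W t f x @[W --> totally] --> sup S.
  by rewrite /heat; move/cvg_lim : (H) => ->.
apply/cvgrPdist_le => e e0.
have [_ [W0 _ <-] W0S] := sup_adherent e0 (conj S0 (ex_intro _ M Sub)).
exists W0 => // W /= W0W.
have H1 : dirichlet_heat G W t f x <= sup S.
  by apply: ub_le_sup; [exists M | exists W].
rewrite ger0_norm ?subr_ge0// lerBlDr -lerBlDl.
by apply: le_trans (ltW W0S) _; exact: dirichlet_heat_mono.
Qed.

Lemma near_totally_in x : \forall W \near @totally V, x \in W.
Proof. by exists [fset x]%fset => // W /=; rewrite fsub1set. Qed.

Lemma heat_ge_dirichlet W t x : 0 <= t -> dirichlet_heat G W t f x <= heat G t f x.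
Proof.
move=> t0; apply: (cvgr_to_ge (heat_cvg (x := x) t0)).
by exists W => // W' WW'; exact: dirichlet_heat_mono.
Qed.

Lemma heat_ge0 t x : 0 <= t -> 0 <= heat G t f x.
Proof.
by move=> t0; apply: le_trans (heat_ge_dirichlet fset0 x t0); exact: dirichlet_heat_ge0.
Qed.

Lemma heat_le t x : 0 <= t -> heat G t f x <= M.
Proof.
move=> t0; apply: (cvgr_to_le (heat_cvg (x := x) t0)); apply: nearW => W.
by apply: dirichlet_heat_le => //; exact: le_trans (f_ge0 x) (f_leM x).
Qed.

Lemma heat_gt0 t x : 0 <= t -> 0 < f x -> 0 < heat G t f x.
Proof.
move=> t0 fx0; apply: lt_le_trans (heat_ge_dirichlet [fset x]%fset x t0).
by apply: lt_le_trans (dirichlet_heat1_lower x f_ge0 t0); rewrite mulr_gt0// expR_gt0.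
Qed.

Lemma heat0 x : heat G 0 f x = f x.
Proof.
apply: cvg_lim => //; apply: cvg_near_cst.
by apply: filterS (near_totally_in x) => W xW; rewrite dirichlet_heat0 restr_in.
Qed.

(** A Lipschitz constant in time at [y], independent of [W]: the time derivative is zero or the
    Laplacian of a function with values in [[0, M]]. *)
Let lip y := 2 * vdeg G y * M.

Let lip_ge0 y : 0 <= lip y.
Proof.
have M0 : 0 <= M by exact: le_trans (f_ge0 y) (f_leM y).
by rewrite mulr_ge0// mulr_ge0// vdeg_ge0.
Qed.

Lemma dirichlet_heat_lip W t s y : 0 <= t -> 0 <= s ->
  `|dirichlet_heat G W s f y - dirichlet_heat G W t f y| <= lip y * `|s - t|.
Proof.
move=> t0 s0.
have [c [c0 _] ->] := mean_value
  (fun u _ => is_derive_dirichlet_heat lfG W f y u) t0 s0.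
rewrite normrM ler_wpM2r// /restr; case: ifP => _; last first.
  by rewrite normr0.
apply: laplacian_norm_le => // z.
rewrite ger0_norm ?dirichlet_heat_ge0// dirichlet_heat_le//.
exact: le_trans (f_ge0 y) (f_leM y).
Qed.

Definition taylor_cst x : R :=
  (vmeas G x)^-1 * \sum_(y <- nbhd G x) weight G x y * (lip y + lip x).

Lemma taylor_cst_ge0 x : 0 <= taylor_cst x.
Proof.
rewrite mulr_ge0 ?invr_ge0 ?(ltW (vmeas_gt0 _ _))// sumr_ge0// => y _.
by rewrite mulr_ge0 ?weight_ge0// addr_ge0.
Qed.

(* The second time derivative of the Dirichlet solutions is bounded at each
   vertex uniformly in [W], which is what makes the heat equation survive the
   limit [W -> V]. *)
Lemma dirichlet_heat_taylor W t s x : x \in W -> 0 <= t -> 0 <= s ->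
  `|dirichlet_heat G W s f x - dirichlet_heat G W t f x -
    (s - t) * laplacian G (dirichlet_heat G W t f) x| <= taylor_cst x * (s - t) ^+ 2.
Proof.
move=> xW t0 s0.
have [c [c0 ct] ->] := mean_value
  (fun u _ => is_derive_dirichlet_heat lfG W f x u) t0 s0.
(* The remainder is [s - t] times the Laplacian of the increment between [t] and [c], and [c] is no
   farther from [t] than [s] is. *)
rewrite restr_in// mulrC -mulrBr -laplacianB// normrM.
rewrite -[leRHS](_ : `|s - t| * (`|s - t| * taylor_cst x) = _); last first.
  by rewrite mulrA -expr2 real_normK ?num_real// mulrC.
rewrite ler_wpM2l//.
apply: le_trans (laplacian_lip_le lfG x
  (fun y => dirichlet_heat_lip W y t0 c0)) _.
under eq_bigr do rewrite -mulrDl mulrA.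
rewrite -mulr_suml mulrA mulrC ler_wpM2r//.
exact: taylor_cst_ge0.
Qed.

Lemma heat_taylor t s x : 0 <= t -> 0 <= s ->
  `|heat G s f x - heat G t f x - (s - t) * laplacian G (heat G t f) x| <=
    taylor_cst x * (s - t) ^+ 2.
Proof.
move=> t0 s0.
have H : `|dirichlet_heat G W s f x - dirichlet_heat G W t f x -
    (s - t) * laplacian G (dirichlet_heat G W t f) x| @[W --> totally] -->
    `|heat G s f x - heat G t f x - (s - t) * laplacian G (heat G t f) x|.
  apply: cvg_norm; apply: cvgB; first by apply: cvgB; exact: heat_cvg.
  by apply: cvgMr; apply: cvg_laplacian => // y; exact: heat_cvg.
apply: (cvgr_to_le H); apply: filterS (near_totally_in x) => W xW.
exact: dirichlet_heat_taylor.
Qed.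

(* [heat] is only meaningful for [t >= 0]; the affine extension makes the time
   derivative at [t = 0] two-sided. *)
Definition heat_ext t x : R :=
  if 0 <= t then heat G t f x else f x + t * laplacian G f x.

Lemma heat_extE t x : 0 <= t -> heat_ext t x = heat G t f x.
Proof. by rewrite /heat_ext => ->. Qed.

Lemma is_derive_heat_ext t x : 0 <= t ->
  is_derive t 1 (heat_ext^~ x) (laplacian G (heat G t f) x).
Proof.
(* For [t > 0], [|h| < t] keeps [t + h] positive; at [t = 0] any radius works, since the affine
   branch has no remainder. *)
move=> t0; pose a := if t == 0 then 1 else t.
apply: (@is_derive1_quad _ _ _ _ (taylor_cst x) a) => [|h ha].
  by rewrite /a; case: eqVneq => // tn0; rewrite lt_def tn0.
have [th0|th0] := leP 0 (t + h).
  have := heat_taylor x t0 th0; rewrite !heat_extE//.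
  by rewrite (_ : t + h - t = h); last ring.
move: ha; rewrite /a; case: eqVneq => [tE _|_ ht]; last first.
  by exfalso; move: ht; rewrite ltr_norml => /andP[]; lra.
rewrite tE add0r in th0 *.
rewrite {1}/heat_ext (leNgt 0 h) th0/= heat_extE// heat0.
have -> : heat G 0 f = f by apply/funext => y; exact: heat0.
rewrite [X in `|X|](_ : _ = 0) ?normr0; last ring.
by rewrite mulr_ge0 ?sqr_ge0// taylor_cst_ge0.
Qed.

(** Negative times are included because the maximum principle for finite families asks for
    continuity on the whole line. *)
Lemma continuous_heat_ext x : continuous (heat_ext^~ x).
Proof.
move=> t; have [t0|t0] := leP 0 t.
  exact: is_derive1_continuous (is_derive_heat_ext x t0).
apply: (@is_derive1_continuous _ _ _ (laplacian G f x)).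
apply: (@is_derive1_quad _ _ _ _ 0 (- t)) => [|h]; first by rewrite oppr_gt0.
rewrite ltr_norml => /andP[_ ht].
rewrite /heat_ext (leNgt 0 t) (leNgt 0 (t + h)) t0 (_ : t + h < 0)/=; last by lra.
by rewrite [X in `|X|](_ : _ = 0) ?normr0 ?mul0r//; ring.
Qed.

End Bounded.
End HeatSemigroup.

(** * From the gradient estimate to curvature *)

Section Curvature.
Context {R : realType} {V : choiceType} (G : weighted_graph R V).
Hypothesis lfG : locally_finite G.
Implicit Types (f g : V -> R) (x y z : V) (t s M K : R) (r n : nat).

Definition curvature_term r g x y : R :=
  laplacian G (fun z => Rgrad G r g z ^+ 2) x
  - Num.sg (g y - g x)
    * (laplacian G (fun z => g z ^+ 2) y / g y
       - laplacian G (fun z => g z ^+ 2) x / g x).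

Lemma Kq_geP K r x y : (K%:E <= Kq G r x y)%E <->
  (forall g, (forall z, 0 < g z) -> Rgrad G r g x = 1 -> `|g y - g x| = 1 ->
    2 * K <= curvature_term r g x y).
Proof.
have E : K%:E = ((2^-1)%:E * (2 * K)%:E)%E by rewrite -EFinM mulrA mulVf ?mul1r.
rewrite /Kq {}E lee_pmul2l ?lte_fin ?invr_gt0//.
split=> [H g g0 g1 gxy|H].
  have : ((2 * K)%:E <= (curvature_term r g x y)%:E)%E.
    by apply: le_trans H _; apply: ereal_inf_lbound; exists g.
  by rewrite lee_fin.
by apply: le_ereal_inf_tmp => _ [g [g0 g1 gxy] <-]; rewrite lee_fin; exact: H.
Qed.

Lemma sg_unit (a : R) : `|a| = 1 -> Num.sg a = a.
Proof.
move=> a1; have [a0|a0|a0] := ltgtP a 0.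
- by rewrite ltr0_sg//; move: a1; rewrite ltr0_norm// => <-; rewrite opprK.
- by rewrite gtr0_sg//; move: a1; rewrite gtr0_norm.
- by move: a1; rewrite a0 normr0 => /esym/eqP; rewrite oner_eq0.
Qed.

(** Both sides are homogeneous of degree two in [g], so the normalization is removed by dividing [g]
    by [|g y - g x|]; the sign of a number of modulus one is that number, which replaces [sgn] by
    the difference. *)
Lemma Kq_scaled K r x y g : (K%:E <= Kq G r x y)%E -> (forall z, 0 < g z) ->
  Rgrad G r g x = `|g y - g x| -> 0 < `|g y - g x| ->
  2 * K * (g y - g x) ^+ 2 <= laplacian G (fun z => Rgrad G r g z ^+ 2) x
    - (g y - g x) * (laplacian G (fun z => g z ^+ 2) y / g y
       - laplacian G (fun z => g z ^+ 2) x / g x).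
Proof.
move=> /Kq_geP H g0 gx a0; set a := `|g y - g x| in gx a0 *.
have a'0 : 0 < a^-1 by rewrite invr_gt0.
have /= := H (fun z => a^-1 * g z) (fun z => mulr_gt0 a'0 (g0 z)).
rewrite Rgrad_scale ?(ltW a'0)// gx mulVf ?gt_eqF// => /(_ erefl).
rewrite -mulrBr normrM (gtr0_norm a'0) -/a mulVf ?gt_eqF// => /(_ erefl).
rewrite /curvature_term -mulrBr.
have -> : (fun z => Rgrad G r (fun z => a^-1 * g z) z ^+ 2) =
    fun z => a^-1 ^+ 2 * Rgrad G r g z ^+ 2.
  by apply/funext => z; rewrite Rgrad_scale ?(ltW a'0)// exprMn.
have -> : (fun z => (a^-1 * g z) ^+ 2) = fun z => a^-1 ^+ 2 * g z ^+ 2.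
  by apply/funext => z; rewrite exprMn.
rewrite !laplacianZ//.
rewrite sg_unit; last by rewrite normrM (gtr0_norm a'0) -/a mulVf ?gt_eqF.
set A := laplacian _ _ _; set B := laplacian _ _ y; set C := laplacian _ _ x.
have aE : a ^+ 2 = (g y - g x) ^+ 2 by rewrite real_normK ?num_real.
rewrite -aE -(ler_pM2r (exprn_gt0 2 a0)) => /le_trans; apply.
have := g0 x; have := g0 y; move=> gy gx0.
by rewrite le_eqVlt; apply/orP; left; apply/eqP; field; rewrite !gt_eqF.
Qed.

Lemma is_derive_sqrt_heat f M t x : (forall z, 0 < f z <= M) -> 0 <= t ->
  is_derive t 1 (fun t => Num.sqrt (heat_ext G f t x))
    (laplacian G (heat G t f) x / (2 * Num.sqrt (heat G t f x))).
Proof.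
move=> fM t0.
have fM' z : 0 <= f z <= M by have /andP[/ltW -> ->] := fM z.
have fx0 : 0 < f x by have /andP[] := fM x.
have -> : (fun t => Num.sqrt (heat_ext G f t x)) = Num.sqrt \o (heat_ext G f)^~ x by [].
rewrite mulrC; apply: is_derive1_comp; last exact: is_derive_heat_ext fM' _ _ t0.
rewrite heat_extE//; apply: is_derive1_sqrt; exact: heat_gt0 fM' _ _ t0 fx0.
Qed.

Lemma is_derive_sqr_diff (u v : R -> R) (t du dv : R) :
  is_derive t 1 u du -> is_derive t 1 v dv ->
  is_derive t 1 (fun s => (u s - v s) ^+ 2) (2 * (u t - v t) * (du - dv)).
Proof.
move=> ud vd; have uvd := is_deriveB ud vd.
have := is_derive_realM uvd uvd.
have -> : (fun s => (u s - v s) ^+ 2) = (fun s => (u - v) s * (u - v) s).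
  by apply/funext => s; rewrite expr2.
move/is_derive_eq; apply.
by rewrite -[(u - v) t]/(u t - v t); ring.
Qed.

Lemma is_derive_sqrt_heat_diff f M t x y : (forall z, 0 < f z <= M) -> 0 <= t ->
  let g z := Num.sqrt (heat G t f z) in
  is_derive t 1
    (fun t => (Num.sqrt (heat_ext G f t y) - Num.sqrt (heat_ext G f t x)) ^+ 2)
    ((g y - g x) * (laplacian G (fun z => g z ^+ 2) y / g y
                    - laplacian G (fun z => g z ^+ 2) x / g x)).
Proof.
move=> fM t0 g.
have fM' z : 0 <= f z <= M by have /andP[/ltW -> ->] := fM z.
have -> : (fun z => g z ^+ 2) = heat G t f.
  by apply/funext => z; rewrite /g sqr_sqrtr// (heat_ge0 lfG fM').
have g0 z : g z != 0.
  rewrite gt_eqF// sqrtr_gt0 (heat_gt0 lfG fM')//.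
  by have /andP[] := fM z.
have := is_derive_sqr_diff (is_derive_sqrt_heat y fM t0) (is_derive_sqrt_heat x fM t0).
move/is_derive_eq; apply; rewrite !heat_extE// -/(g x) -/(g y).
by have := g0 x; have := g0 y => gy gx; field; rewrite gy gx.
Qed.

Lemma le_sum_seq (s : seq V) (u : V -> R) x :
  (forall z, 0 <= u z) -> x \in s -> u x <= \sum_(z <- s) u z.
Proof. by move=> u0 xs; rewrite (big_rem x xs)/= lerDl sumr_ge0. Qed.

Lemma bounded_funP f M : (forall z, `|f z| <= M) -> bounded_fun f.
Proof.
move=> fM; exists M; split=> [|N MN z _]; first exact: num_real.
exact: le_trans (fM z) (ltW MN).
Qed.

Definition gradient_estimate K r := forall f, bounded_fun f -> (forall x, 0 < f x) ->
  forall t, 0 <= t -> forall x,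
    Rgrad G r (fun z => Num.sqrt (heat G t f z)) x ^+ 2
    <= expR (- (2 * K * t))
       * heat G t (fun z => Rgrad G r (fun u => Num.sqrt (f u)) z ^+ 2) x.

Lemma gradient_estimate_Kq K r x y : gradient_estimate K r ->
  (0 < r)%N -> (graph_dist G x y <= r%:R%:E)%E -> (K%:E <= Kq G r x y)%E.
Proof.
move=> H r0 /(graph_dist_leP lfG) yB; apply/Kq_geP => g g0 g1 gxy.
(* The curvature term reads [g] only within distance [r + 1] of [x]: balls of radius [r] around
   neighbors of [x], and neighbors of [y]. Replacing [g] by 1 farther out makes it bounded and keeps
   the term. *)
pose S := ball_seq G r.+1 x.
pose g' z := if z \in S then g z else 1.
have xS : x \in S by exact: ball_seq_refl.
have yS : y \in S by exact: ball_seq_le yB.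
have g'S z : z \in S -> g' z = g z by rewrite /g' => ->.
have g'0 z : 0 < g' z by rewrite /g'; case: ifP.
(* The sum dominates [g] on [S], and the 1 dominates the value off [S]. *)
pose M := (1 + \sum_(z <- S) g z) ^+ 2.
have sum0 : 0 <= \sum_(z <- S) g z by rewrite sumr_ge0// => z _; exact: ltW.
pose f z := g' z ^+ 2.
have sqrtf : (fun z => Num.sqrt (f z)) = g'.
  by apply/funext => z; rewrite /f sqrtr_sqr gtr0_norm.
have fM z : 0 < f z <= M.
  rewrite exprn_gt0//= lerXn2r ?nnegrE ?addr_ge0 ?(ltW (g'0 z))//.
  rewrite /g'; case: ifP => zS; last by rewrite lerDl.
  by rewrite ler_wpDl// (@le_sum_seq S g)// => w; exact: ltW.
have fM' z : 0 <= f z <= M by have /andP[/ltW -> ->] := fM z.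
pose h z := Rgrad G r (fun u => Num.sqrt (f u)) z ^+ 2.
have hM z : 0 <= h z <= M by exact: Rgrad_sqrt_bound.
have bf : bounded_fun f.
  by apply: (@bounded_funP _ M) => z; have /andP[z0 zM] := fM' z; rewrite ger0_norm.
(* Only the pair [x], [y] is kept: its squared difference is differentiable in time, lies below the
   squared gradient, and equals it at time 0. *)
pose A t := (Num.sqrt (heat_ext G f t y) - Num.sqrt (heat_ext G f t x)) ^+ 2.
pose B t := expR (- (2 * K) * t) * heat_ext G h t x.
have AB t : 0 <= t -> A t <= B t.
  move=> t0; have f0 z : 0 < f z by have /andP[] := fM z.
  have := H f bf f0 t t0 x; rewrite /A /B !heat_extE// mulNr; apply: le_trans.
  rewrite -[leLHS]real_normK ?num_real// lerXn2r ?nnegrE ?Rgrad_ge0//.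
  exact: (@Rgrad_ub _ _ _ lfG r (fun z => Num.sqrt (heat G t f z))).
have g'B : forall z, z \in ball_seq G r x -> g' z = g z.
  by move=> z zB; apply: g'S; exact: ball_seq_le zB.
have A0 : A 0 = 1.
  rewrite /A !heat_extE// !heat0 /f !sqrtr_sqr !(gtr0_norm (g'0 _)).
  by rewrite !g'S// -real_normK ?num_real// gxy expr1n.
have hx : h x = 1 by rewrite /h sqrtf (eq_Rgrad lfG g'B) g1 expr1n.
have B0 : B 0 = 1.
  by rewrite /B !heat_extE// heat0 mulr0 expR0 mul1r.
have dA := is_derive_sqrt_heat_diff x y fM (lexx 0).
have dB := is_derive_realM (is_derive_expRM (- (2 * K)) 0)
  (is_derive_heat_ext lfG hM x (lexx 0)).
have BA_min s : 0 < s -> (B - A) 0 <= (B - A) s.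
  move=> s0; rewrite -[leLHS]/(B 0 - A 0) -[leRHS]/(B s - A s) A0 B0 subrr.
  by rewrite subr_ge0 AB// ltW.
have heatf : (fun z => Num.sqrt (heat G 0 f z)) = g'.
  by rewrite -sqrtf; apply/funext => z; rewrite heat0.
have heath : heat G 0 h = h by apply/funext => z; exact: heat0.
have lapS z : z \in ball_seq G r x ->
    laplacian G (fun z => g' z ^+ 2) z = laplacian G (fun z => g z ^+ 2) z.
  move=> zB; apply: eq_laplacian => //; first by rewrite g'B.
  move=> w zw; rewrite g'S// /S -addn1; apply: ball_seq_trans zB _ => //.
  exact: neighbor_ball_seq.
have laph : laplacian G h x = laplacian G (fun z => Rgrad G r g z ^+ 2) x.
  rewrite /h sqrtf; apply: eq_laplacian => //; first by rewrite (eq_Rgrad lfG g'B).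
  move=> w xw; congr (_ ^+ 2); apply: eq_Rgrad => // z zB; apply: g'S.
  by rewrite /S -add1n; apply: ball_seq_trans zB => //; exact: neighbor_ball_seq.
have gE z : Num.sqrt (heat G 0 f z) = g' z by rewrite -heatf.
have sqrE : (fun z => Num.sqrt (heat G 0 f z) ^+ 2) = (fun z => g' z ^+ 2).
  by apply/funext => z; rewrite gE.
(* [A] and [B] agree at 0, so [B - A] has a nonnegative derivative there, and this derivative is the
   curvature term minus [2 * K]. *)
have := is_derive1_right_min (is_deriveB dB dA) BA_min.
rewrite mulr0 expR0 mul1r mulr1 heat_extE// heath hx mul1r laph /= sqrE.
rewrite !gE !lapS ?ball_seq_refl// !g'S// /curvature_term sg_unit//.
by move=> ?; lra.
Qed.

End Curvature.

(** * From curvature to the gradient estimate *)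

Section Lyapunov.
Context {R : realType} {V : choiceType} (G : weighted_graph R V).
Hypothesis lfG : locally_finite G.
Variables (r : nat) (K : R).
Hypothesis Kq_ge : forall x y : V,
  (graph_dist G x y <= r%:R%:E)%E -> (K%:E <= Kq G r x y)%E.
Implicit Types (f g : V -> R) (x y z : V) (n : nat).

(** Twice the carré du champ of [g], the defect of the chain rule for [g ^+ 2]. *)
Definition sqr_grad g x : R :=
  (vmeas G x)^-1 * \sum_(y <- nbhd G x) weight G x y * (g y - g x) ^+ 2.

Lemma sqr_grad_ge0 g x : 0 <= sqr_grad g x.
Proof.
rewrite mulr_ge0 ?invr_ge0 ?(ltW (vmeas_gt0 _ _))// sumr_ge0// => y _.
by rewrite mulr_ge0 ?weight_ge0// sqr_ge0.
Qed.

Lemma laplacian_sqr g x :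
  laplacian G (fun z => g z ^+ 2) x = 2 * g x * laplacian G g x + sqr_grad g x.
Proof.
rewrite !laplacianE// /sqr_grad mulrCA -mulrDr [2 * g x * _]mulr_sumr -big_split/=.
by congr (_ * _); apply: eq_bigr => y _; ring.
Qed.

(* Adding a large constant [C] to [f] linearizes [laplacian (g ^+ 2) / g], so
   the quadratic curvature bound yields the Laplacian comparison of a linear
   Ollivier curvature bound, up to the error [1 / 2]. *)
Lemma laplacian_step f x y : (forall z, 0 <= f z) ->
  (forall z w, w \in ball_seq G r z -> `|f w - f z| <= 1) ->
  y \in ball_seq G r x -> f y = f x + 1 ->
  laplacian G f y <= laplacian G f x - K + 1 / 2.
Proof.
(* This [C] makes the error quotient at [x] at most 1, hence the [1 / 2] after halving; the added 1
   keeps [C] positive. *)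
move=> f0 flip yB fy; pose C := sqr_grad f x + 1.
have C0 : 0 < C by rewrite ltr_wpDl// sqr_grad_ge0.
pose g z := C + f z.
have gB z w : g w - g z = f w - f z by rewrite /g; ring.
have g0 z : 0 < g z by rewrite ltr_wpDr.
have gyx : g y - g x = 1 by rewrite gB fy; ring.
have gradE z : Rgrad G r g z <= 1.
  by apply: Rgrad_le => // w wB; rewrite gB; exact: flip.
have gradx : Rgrad G r g x = 1.
  apply/eqP; rewrite eq_le gradE/= -[leLHS](normr1 R) -[X in `|X|]gyx.
  exact: Rgrad_ub.
have xyd : (graph_dist G x y <= r%:R%:E)%E by apply/graph_dist_leP.
have := Kq_scaled lfG (Kq_ge xyd) g0; rewrite gyx normr1 => /(_ gradx ltr01).
(* The gradient reaches its largest possible value 1 at [x]. *)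
have : laplacian G (fun z => Rgrad G r g z ^+ 2) x <= 0.
  apply: laplacian_max_le0 => // z _; rewrite gradx expr1n.
  by rewrite expr_le1// Rgrad_ge0.
have lapg z : laplacian G g z = laplacian G f z.
  by rewrite laplacianD// laplacian_cst// add0r.
have Gg z : sqr_grad g z = sqr_grad f z.
  by rewrite /sqr_grad; under eq_bigr do rewrite gB.
have quotE z : laplacian G (fun z => g z ^+ 2) z / g z =
    2 * laplacian G f z + sqr_grad f z / g z.
  rewrite laplacian_sqr lapg Gg; have := gt_eqF (g0 z) => /negbT gz.
  by field.
rewrite !quotE expr1n.
(* The quotient at [y] has the favorable sign, so [C] need not depend on [y]. *)
have q1 : 0 <= sqr_grad f y / g y by rewrite divr_ge0 ?sqr_grad_ge0// ltW.
have q2 : sqr_grad f x / g x <= 1.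
  by rewrite ler_pdivrMr// mul1r /g /C -addrA lerDl addr_ge0.
by lra.
Qed.

Variable x0 : V.

Definition in_component x : Prop := exists n, x \in ball_seq G (r * n) x0.

(** The number of jumps of length at most [r] from [x0] to [x]. The default 0 off the component
    keeps the function 1-Lipschitz on all of [V], as no jump enters or leaves the component. *)
Definition rdist x : nat :=
  if pselect (in_component x) is left H then ex_minn H else 0%N.

Lemma rdistP x : in_component x -> x \in ball_seq G (r * rdist x) x0 /\
  forall n, x \in ball_seq G (r * n) x0 -> (rdist x <= n)%N.
Proof.
by rewrite /rdist; case: pselect => // H _; case: ex_minnP.
Qed.

Lemma rdist_out x : ~ in_component x -> rdist x = 0%N.
Proof. by rewrite /rdist; case: pselect. Qed.

Lemma in_component_root : in_component x0.
Proof. by exists 0%N; exact: ball_seq_refl. Qed.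

Lemma rdist_root : rdist x0 = 0%N.
Proof.
have [_ H] := rdistP in_component_root.
by apply/eqP; rewrite -leqn0; apply: H; exact: ball_seq_refl.
Qed.

Lemma rdist_step x y : in_component x -> y \in ball_seq G r x ->
  in_component y /\ (rdist y <= (rdist x).+1)%N.
Proof.
move=> cx yB; have [xB _] := rdistP cx.
have yB' : y \in ball_seq G (r * (rdist x).+1) x0.
  by rewrite mulnS addnC; exact: ball_seq_trans xB yB.
have cy : in_component y by exists (rdist x).+1.
by split=> //; have [_] := rdistP cy; exact.
Qed.

Lemma rdist_lip x y : y \in ball_seq G r x -> `|(rdist y)%:R - (rdist x)%:R| <= 1 :> R.
Proof.
move=> yB; have xB : x \in ball_seq G r y by rewrite ball_seq_sym.
have [cx|cx] := pselect (in_component x).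
  have [cy] := rdist_step cx yB; have [_] := rdist_step cy xB.
  rewrite -2!(ler_nat R) -!natr1 => a b.
  by rewrite ler_norml; apply/andP; split; lra.
have [cy|cy] := pselect (in_component y); first by have [] := rdist_step cy xB.
by rewrite !rdist_out// subrr normr0.
Qed.

Lemma rdist_pred x n : in_component x -> rdist x = n.+1 ->
  exists y, [/\ in_component y, rdist y = n & x \in ball_seq G r y].
Proof.
move=> cx xn; have [] := rdistP cx; rewrite xn mulnS addnC => xB xmin.
have [y yB xyB] := ball_seq_split lfG xB.
have cy : in_component y by exists n.
exists y; split=> //; apply/eqP; rewrite eqn_leq.
have [_ ymin] := rdistP cy; rewrite ymin//=.
by have [_] := rdist_step cy xyB; rewrite xn.
Qed.

Let d x : R := (rdist x)%:R.

(** Induction along predecessors down to [x0]: each jump adds at most [- K + 1 / 2 <= |K| + 1]. *)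
Lemma laplacian_rdist_le x : in_component x ->
  laplacian G d x <= `|laplacian G d x0| + (`|K| + 1) * d x.
Proof.
move En : (rdist x) => n; elim: n x En => [|n IH] x xn cx.
  have [xB _] := rdistP cx; move: xB; rewrite xn muln0 inE => /eqP ->.
  by rewrite /d rdist_root mulr0 addr0 ler_norm.
have [y [cy yn xB]] := rdist_pred cx xn.
have dx : d x = d y + 1 by rewrite /d xn yn natr1.
have H1 := @laplacian_step d y x (fun z => ler0n _ _) rdist_lip xB dx.
have H2 := IH y yn cy; have := ler_norm (- K); rewrite normrN => H3.
by rewrite dx; lra.
Qed.

(** The set [P], closed under neighbors, is the component of [x0]; off it [rdist] vanishes and
    cannot be proper. *)
Lemma lyapunov_function : (0 < r)%N -> exists (phi : V -> R) (lam : R) (P : V -> Prop),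
  [/\ P x0 /\ (forall x y, P x -> neighbor G x y -> P y),
      0 <= lam,
      forall x, 0 <= phi x,
      forall x, P x -> laplacian G phi x <= lam * phi x &
      forall c : R, exists s : seq V, forall x, P x -> phi x <= c -> x \in s].
Proof.
(* The additive constant absorbs the Laplacian of [d] at the root, because [lam >= 1]. *)
move=> r0; exists (fun x => `|laplacian G d x0| + d x), (`|K| + 1), in_component.
split.
- split=> [|x y cx xy]; first exact: in_component_root.
  by have [] := rdist_step cx (neighbor_ball_seq lfG r0 xy).
- by rewrite addr_ge0.
- by move=> x; rewrite addr_ge0// ler0n.
- move=> x cx; rewrite laplacianD// laplacian_cst// add0r.
  apply: le_trans (laplacian_rdist_le cx) _; rewrite mulrDr lerD2r.
  by rewrite mulrDl mul1r lerDr mulr_ge0.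
- move=> c; exists (ball_seq G (r * Num.bound c) x0) => x cx xc.
  have [xB _] := rdistP cx; apply: ball_seq_le xB => //.
  rewrite leq_mul2l; apply/orP; right.
  have dc : d x <= c by apply: le_trans xc; rewrite lerDr.
  have c0 : 0 <= c by apply: le_trans dc; exact: ler0n.
  by rewrite -(ler_nat R) (le_trans dc)// ltW// archi_boundP.
Qed.

End Lyapunov.

(** The arithmetic at a positive maximum. [D] and [T] are a squared difference and its time
    derivative, [W] the Laplacian of the squared gradient, [U] and [LU] the heat flow and its
    Laplacian, [p] and [Lp] those of [phi]. In the damping rate [lam + 1], [lam] pays for [Lp] and
    the 1 gives strictness. *)
Lemma derivative_neg (R : realFieldType) (e1 e2 D T W U LU lam eps p Lp K : R) :
  0 < e1 -> 0 < eps -> 0 <= p -> 0 <= lam ->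
  T <= W - 2 * K * D -> e1 * W - e2 * LU - eps * Lp <= 0 -> Lp <= lam * p ->
  0 < e1 * D - e2 * U - eps * p ->
  e1 * T + D * ((2 * K - (lam + 1)) * e1)
    - (e2 * LU + U * (- (lam + 1) * e2)) - 0 < 0.
Proof.
move=> e10 eps0 p0 lam0 evo psi_le phi_le pos.
have h1 := ler_wpM2l (ltW e10) evo.
have h2 := ler_wpM2l (ltW eps0) phi_le.
have h3 := mulr_ge0 (ltW eps0) p0.
have h4 := mulr_ge0 lam0 (ltW pos).
by lra.
Qed.

(** * Maximum principle on pairs of vertices *)

Section GradientEstimate.
Context {R : realType} {V : choiceType} (G : weighted_graph R V).
Hypothesis lfG : locally_finite G.
Variables (r : nat) (K : R).
Hypothesis r_gt0 : (0 < r)%N.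
Hypothesis Kq_ge : forall x y : V,
  (graph_dist G x y <= r%:R%:E)%E -> (K%:E <= Kq G r x y)%E.
Implicit Types (x y z : V) (t s : R).

Variables (f : V -> R) (M : R).
Hypothesis fM : forall z, 0 < f z <= M.

Let fM' z : 0 <= f z <= M. Proof. by have /andP[/ltW -> ->] := fM z. Qed.
Let g t z := Num.sqrt (heat G t f z).
Let h z := Rgrad G r (fun u => Num.sqrt (f u)) z ^+ 2.
Let hM z : 0 <= h z <= M. Proof. exact: Rgrad_sqrt_bound. Qed.

Lemma evolution_inequality t x y : 0 <= t -> y \in ball_seq G r x ->
  Rgrad G r (g t) x = `|g t y - g t x| -> 0 < `|g t y - g t x| ->
  (g t y - g t x) * (laplacian G (fun z => g t z ^+ 2) y / g t y
     - laplacian G (fun z => g t z ^+ 2) x / g t x) <=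
  laplacian G (fun z => Rgrad G r (g t) z ^+ 2) x - 2 * K * (g t y - g t x) ^+ 2.
Proof.
move=> t0 /(graph_dist_leP lfG)/Kq_ge Kxy gx gxy.
rewrite lerBrDl -lerBrDr; apply: (Kq_scaled lfG Kxy) => // z.
by rewrite sqrtr_gt0 (heat_gt0 lfG fM')//; have /andP[] := fM z.
Qed.

Lemma Kq_gradient_estimate t x : 0 <= t ->
  Rgrad G r (g t) x ^+ 2 <= expR (- (2 * K * t)) * heat G t h x.
Proof.
move=> t0.
have [phi [lam [P [[Px Pnbr] lam0 phi0 phi_lap phi_proper]]]] :=
  lyapunov_function lfG Kq_ge x r_gt0.
(* Both terms are damped by [expR (- mu * s)]; the additional [2 * K] in [a] removes the curvature
   term from the comparison. *)
pose mu := lam + 1; pose a := 2 * K - mu.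
have [y0 y0B [gradx _]] := Rgrad_attained lfG r (g t) x.
have M0 : 0 <= M by have /andP[/le_trans] := hM x; exact.
(* The penalty [eps * phi] confines the maximum principle to finitely many vertices; [eps] then
   tends to 0. *)
suff main eps : 0 < eps ->
    expR (a * t) * (g t y0 - g t x) ^+ 2 - expR (- mu * t) * heat G t h x <=
    eps * phi x.
  have {}main : expR (a * t) * (g t y0 - g t x) ^+ 2 <= expR (- mu * t) * heat G t h x.
    apply/ler_addgt0Pr => e e0.
    have phi1 : 0 < phi x + 1 by rewrite ltr_wpDl.
    rewrite -lerBlDl; apply: le_trans (main _ (divr_gt0 e0 phi1)) _.
    by rewrite mulrAC ler_pdivrMr// ler_pM2l// lerDl.
  rewrite gradx real_normK ?num_real// expRN -(ler_pM2l (expR_gt0 (a * t))).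
  apply: le_trans main _; rewrite mulrA ler_wpM2r ?(heat_ge0 lfG hM)//.
  rewrite -expRN -expRD le_eqVlt; apply/orP; left; apply/eqP; congr expR.
  by rewrite /a; ring.
move=> eps0.
(* Pairs replace the gradient, a maximum that need not be differentiable in time. *)
pose F (p : V * V) s := expR (a * s) *
    (Num.sqrt (heat_ext G f s p.2) - Num.sqrt (heat_ext G f s p.1)) ^+ 2 -
  expR (- mu * s) * heat_ext G h s p.1 - eps * phi p.1.
have FE p s : 0 <= s -> F p s = expR (a * s) * (g s p.2 - g s p.1) ^+ 2 -
    expR (- mu * s) * heat G s h p.1 - eps * phi p.1.
  by move=> s0; rewrite /F !heat_extE.
rewrite -subr_le0 -(FE (x, y0))//.
have gM s z : 0 <= s -> 0 <= g s z <= Num.sqrt M.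
  by move=> s0; rewrite sqrtr_ge0 ler_wsqrtr// (heat_le lfG fM').
(* Once [phi] reaches the level [c], the penalty exceeds [E * M], which bounds the first term of [F]
   up to time [t]. *)
pose E := expR (`|a| * t); pose c := E * M / eps.
have F_far z w s : 0 <= s -> s <= t -> c <= phi z -> F (z, w) s <= 0.
  move=> s0 st cz; rewrite FE//=.
  have H1 : expR (a * s) * (g s w - g s z) ^+ 2 <= E * M.
    apply: ler_pM; rewrite ?expR_ge0 ?sqr_ge0//.
      rewrite /E ler_expR; apply: le_trans (ler_wpM2r s0 (ler_norm a)) _.
      by rewrite ler_wpM2l.
    rewrite -(sqr_sqrtr M0) -[leLHS]real_normK ?num_real// lerXn2r ?nnegrE ?sqrtr_ge0//.
    have /andP[a1 a2] := gM s z s0; have /andP[b1 b2] := gM s w s0.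
    by rewrite ler_norml; apply/andP; split; lra.
  have H2 : E * M <= eps * phi z by rewrite [leRHS]mulrC -ler_pdivrMr.
  have H3 : 0 <= expR (- mu * s) * heat G s h z.
    by rewrite mulr_ge0 ?expR_ge0 ?(heat_ge0 lfG hM).
  by lra.
have [sx sxP] := phi_proper c.
(* Every pair based in [P], within distance [r], and missing from this list has [phi > c], hence
   [F <= 0]. *)
pose S := [seq (z, w) | z <- [seq z <- sx | `[< P z >]], w <- ball_seq G r z].
have SP z w : (z, w) \in S -> P z /\ w \in ball_seq G r z.
  by move=> /allpairsPdep[z' [w' [+ + [-> ->]]]]; rewrite mem_filter => /andP[/asboolP].
have Sin z w : P z -> w \in ball_seq G r z -> phi z <= c -> (z, w) \in S.
  move=> Pz wB zc; apply/allpairsPdep; exists z, w; split=> //.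
  by rewrite mem_filter sxP// andbT; apply/asboolP.
have [cx|xc] := leP c (phi x); first exact: F_far.
apply: (@finite_family_max_principle _ _ S F t) => //; last by apply: Sin => //; exact: ltW.
- move=> [z w] _ s; rewrite /F/=.
  have ce b : {for s, continuous (fun s => expR (b * s))}.
    exact: is_derive1_continuous (is_derive_expRM b s).
  have cs u : {for s, continuous (fun s => Num.sqrt (heat_ext G f s u))}.
    apply: (@continuous_comp _ _ _ (heat_ext G f ^~ u) Num.sqrt).
      exact: (continuous_heat_ext lfG fM').
    exact: sqrt_continuous.
  apply: cvgB; last exact: cvg_cst.
  apply: cvgB.
    apply: cvgM; first exact: ce.
    under eq_fun do rewrite expr2.
    by rewrite expr2; apply: cvgM; apply: cvgB; exact: cs.
  by apply: cvgM; [exact: ce | exact: (continuous_heat_ext lfG hM)].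
- move=> [z w] /SP[Pz wB]; rewrite FE//= !mulr0 expR0 !mul1r !heat0 subr_le0.
  apply: (@le_trans _ _ 0); last by rewrite mulr_ge0// ltW.
  rewrite subr_le0 /h -[leLHS]real_normK ?num_real// lerXn2r ?nnegrE ?Rgrad_ge0//.
  by rewrite /g !heat0; exact: (@Rgrad_ub _ _ _ lfG r (fun u => Num.sqrt (f u))).
move=> [z w] s zwS s_gt0 st Fpos Fmax.
have s0 := ltW s_gt0; have [Pz wB] := SP _ _ zwS.
have U0 u : 0 <= heat G s h u by exact: (heat_ge0 lfG hM).
have e1 := expR_gt0 (a * s); have e2 := expR_gt0 (- mu * s).
have phiz := phi0 z.
(* Only the squared difference in [F] depends on the second vertex, so a maximal pair realizes the
   gradient at [z]. *)
have gradz : Rgrad G r (g s) z = `|g s w - g s z|.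
  have [w' w'B [-> w'max]] := Rgrad_attained lfG r (g s) z.
  apply/eqP; rewrite eq_le w'max// andbT.
  have := Fmax (z, w').
  have -> : (z, w') \in S.
    apply: Sin => //; rewrite leNgt; apply/negP => zc.
    by move: Fpos; rewrite ltNge F_far// ltW.
  move=> /(_ isT); rewrite !FE//= !lerD2r ler_pM2l//.
  by move=> H; rewrite -ler_sqr ?nnegrE ?normr_ge0// !real_normK ?num_real.
have gpos : 0 < `|g s w - g s z|.
  rewrite normr_gt0; apply/eqP => g0; move: Fpos; rewrite FE//= g0 expr0n/= mulr0.
  by rewrite sub0r -opprD oppr_gt0 ltNge addr_ge0// mulr_ge0// ltW.
have evo := evolution_inequality s0 wB gradz gpos.
(* [F] maximized over the second vertex: [psi] equals [F] at a gradient-realizing pair, so no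
   neighbor of [z] exceeds [psi z]. *)
pose psi u := expR (a * s) * Rgrad G r (g s) u ^+ 2 - expR (- mu * s) * heat G s h u -
  eps * phi u.
have psiz : psi z = F (z, w) s by rewrite FE//= /psi gradz real_normK ?num_real.
have lap_psi : laplacian G psi z <= 0.
  apply: laplacian_max_le0 => // u zu; rewrite psiz.
  have [u' u'B [gradu _]] := Rgrad_attained lfG r (g s) u.
  have -> : psi u = F (u, u') s by rewrite FE//= /psi gradu real_normK ?num_real.
  have [cu|uc] := leP c (phi u); first by rewrite (le_trans _ (ltW Fpos))// F_far.
  by apply: Fmax; apply: Sin (ltW uc) => //; exact: Pnbr zu.
rewrite /psi !laplacianB// !laplacianZ// in lap_psi.
have phi_z := phi_lap z Pz.
have d1 := is_derive_realM (is_derive_expRM a s) (is_derive_sqrt_heat_diff lfG z w fM s0).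
have d2 := is_derive_realM (is_derive_expRM (- mu) s) (is_derive_heat_ext lfG hM z s0).
have d3 := is_derive_cst (eps * phi z) s 1.
exists (expR (a * s) * ((g s w - g s z) * (laplacian G (fun z => g s z ^+ 2) w / g s w -
      laplacian G (fun z => g s z ^+ 2) z / g s z)) +
    (g s w - g s z) ^+ 2 * (a * expR (a * s)) -
  (expR (- mu * s) * laplacian G (heat G s h) z +
    heat G s h z * (- mu * expR (- mu * s))) - 0).
  apply: is_derive_eq (is_deriveB (is_deriveB d1 d2) d3) _.
  by rewrite !heat_extE.
move: Fpos; rewrite FE//= => Fpos.
exact: (derivative_neg e1 eps0 phiz lam0 evo lap_psi phi_z Fpos).
Qed.

End GradientEstimate.

Theorem theorem1p7 (R : realType) (V : choiceType) (G : weighted_graph R V)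
    (lfG : locally_finite G) (r : nat) (r_ge1 : (1 <= r)%N) (K : R) :
  (forall x y : V, (graph_dist G x y <= r%:R%:E)%E -> (K%:E <= Kq G r x y)%E)
  <->
  (forall f : V -> R, bounded_fun f -> (forall x, 0 < f x) ->
   forall t : R, 0 <= t -> forall x : V,
     Rgrad G r (fun z => Num.sqrt (heat G t f z)) x ^+ 2
     <= expR (- (2 * K * t))
        * heat G t (fun z => Rgrad G r (fun u => Num.sqrt (f u)) z ^+ 2) x).
Proof.
split=> [Kq_ge f [M [_ fM]] f0 t t0 x|H x y xy]; last first.
  by apply: gradient_estimate_Kq => //.
(* [bounded_fun] bounds [f] only by the numbers strictly above [M], hence [M + 1]. *)
apply: (@Kq_gradient_estimate _ _ _ lfG r K r_ge1 Kq_ge f (M + 1)) => // z.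
by rewrite f0/= (le_trans (ler_norm _))// fM ?ltrDl.
Qed.
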